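(* Let $(X,D,P)$ be a complete perturbed metric space with exact metric $d=D-P$. Let $T:X\to X$ and let $a,b,c,h,e\ge 0$ be such that for all $x,y\in X$ $$D(Tx,Ty)\le a\,D(x,y)+b\,D(x,Tx)+c\,D(y,Ty)+h\,D(x,Ty)+e\,D(y,Tx).$$ Let $a_0,b_0,c_0,h_0,e_0\ge 0$ be constants such that for all $x,y\in X$ $$a\,P(x,y)+b\,P(x,Tx)+c\,P(y,Ty)+h\,P(x,Ty)+e\,P(y,Tx)\le a_0\,d(x,y)+b_0\,d(x,Tx)+c_0\,d(y,Ty)+h_0\,d(x,Ty)+e_0\,d(y,Tx),$$ and suppose $(a+a_0)+(b+b_0)+(c+c_0)+(h+h_0)+(e+e_0)<1$. Put $A=a+a_0$, $B=b+b_0$, $C=c+c_0$, $H=h+h_0$, $E=e+e_0$, and let $x^\ast$ be the unique fixed point of $T$ (which exists under these hypotheses). Then for every $\varepsilon>0$ and every $u\in X$ with $D(u,Tu)\le\varepsilon$, $$d(u,x^\ast)\le\frac{1+B+E}{1-(A+H+E)}\;\varepsilon.$$ In particular, the fixed point equation $x=Tx$ is Ulam-Hyers stable, with a constant explicit in $a,b,c,h,e,a_0,b_0,c_0,h_0,e_0$.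
   Context: A perturbed metric space $(X,D,P)$ consists of a nonempty set $X$ and two functions $D,P:X\times X\to[0,\infty)$ such that $d(x,y):=D(x,y)-P(x,y)$ is a metric on $X$, called the exact metric. Neither $D$ nor $P$ is assumed symmetric. $(X,D,P)$ is called complete if the metric space $(X,d)$ is complete. A point $u\in X$ with $D(u,Tu)\le\varepsilon$ is called an observed $\varepsilon$-solution of $x=Tx$. Ulam-Hyers stability of $x=Tx$ means here that there is a constant $K\ge 0$ such that $d(u,x^\ast)\le K\varepsilon$ for every $\varepsilon>0$ and every observed $\varepsilon$-solution $u$. *)

(* Defs.v *)
From HB Require Import structures.
From mathcomp Require Import all_boot all_order all_algebra.
From mathcomp Require Import all_classical all_reals all_analysis.

Set Implicit Arguments.
Unset Strict Implicit.
Unset Printing Implicit Defensive.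

Import Order.TTheory GRing.Theory Num.Theory.

Local Open Scope ring_scope.

(* [odist] is the observed distance D, [pert] the perturbation P, and the
   exact metric d = D - P is the library distance [mdist]; so the topology and
   the uniformity are those of d. Neither [odist] nor [pert] need be symmetric
   or vanish on the diagonal. *)
HB.mixin Record Metric_isPerturbed (R : realType) X & Metric R X := {
  odist : X -> X -> R ;
  pert : X -> X -> R ;
  odist_ge0 : forall x y, 0 <= odist x y ;
  pert_ge0 : forall x y, 0 <= pert x y ;
  mdist_pert : forall x y, mdist x y = odist x y - pert x y
}.

(* [isPointed] accounts for nonemptiness. *)
#[short(type="perturbedMetricType")]
HB.structure Definition PerturbedMetric (R : realType) :=
  { X of Metric R X & isPointed X & Metric_isPerturbed R X }.

#[short(type="completePerturbedMetricType")]
HB.structure Definition CompletePerturbedMetric (R : realType) :=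
  { X of PerturbedMetric R X & Complete X }.

(* Any D, P >= 0 such that D - P satisfies the metric axioms determine a
   perturbed metric space. *)
HB.factory Record isPerturbedMetric (R : realType) X & Pointed X := {
  odist : X -> X -> R ;
  pert : X -> X -> R ;
  odist_ge0 : forall x y, 0 <= odist x y ;
  pert_ge0 : forall x y, 0 <= pert x y ;
  exactxx : forall x, odist x x - pert x x = 0 ;
  exact_positivity : forall x y, odist x y - pert x y = 0 -> x = y ;
  exact_sym : forall x y, odist x y - pert x y = odist y x - pert y x ;
  exact_triangle : forall y x z,
    odist x z - pert x z <= (odist x y - pert x y) + (odist y z - pert y z)
}.

HB.builders Context R X & isPerturbedMetric R X.

HB.instance Definition _ := @isMetric.Build R X
  (fun x y => odist x y - pert x y)
  exactxx exact_positivity exact_sym exact_triangle.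

HB.instance Definition _ := @Metric_isPerturbed.Build R X
  odist pert odist_ge0 pert_ge0 (fun x y => erefl).

HB.end.

Section UlamHyers.
Context {R : realType} {X : perturbedMetricType R}.
Implicit Types (T : X -> X) (u xs : X) (eps K : R).

Definition observed_solution T eps u := odist u (T u) <= eps.

Definition ulam_hyers_constant T xs K :=
  0 <= K /\ forall eps u, 0 < eps -> observed_solution T eps u ->
    mdist u xs <= K * eps.

Definition ulam_hyers_stable T xs := exists K, ulam_hyers_constant T xs K.

End UlamHyers.

(* Main.v *)
(** Since [0 <= P], the hypotheses on [D] and [P] add up to the Hardy-Rogers
    inequality for the exact metric [d], with coefficients [A, B, C, H, E] of
    sum [< 1]. Applying it to [(x, y)] and using the triangle inequality yields
      [(1 - (A + H + E)) d(x, y) <= (1 + B + E) d(x, Tx) + (1 + C + H) d(y, Ty)],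
    which at [y = x*] is the stability estimate and at two fixed points is
    uniqueness. It also makes a Picard orbit Cauchy as soon as the displacements
    [d(x, Tx)] tend to [0] along it; they decrease geometrically by averaging
    the inequality at [(x, Tx)] and at [(Tx, x)]. *)
Require Import Defs.
From HB Require Import structures.
From mathcomp Require Import all_boot all_order all_algebra.
From mathcomp Require Import lra.
From mathcomp Require Import all_classical all_reals all_analysis.

Set Implicit Arguments.
Unset Strict Implicit.
Unset Printing Implicit Defensive.

Import Order.TTheory GRing.Theory Num.Theory.

Local Open Scope classical_set_scope.
Local Open Scope ring_scope.

Definition hardy_rogers (R : realType) (X : metricType R) (T : X -> X)
    (A B C H E : R) :=
  forall x y : X,
    mdist (T x) (T y) <=
      A * mdist x y + B * mdist x (T x) + C * mdist y (T y)
      + H * mdist x (T y) + E * mdist y (T x).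

Lemma mdist_le_odist (R : realType) (X : perturbedMetricType R) (x y : X) :
  mdist x y <= odist x y.
Proof. by rewrite mdist_pert gerBl pert_ge0. Qed.

(** Substituting [D = d + P] on the right of the first hypothesis leaves exactly the [P]-terms that
    the second one bounds by [d]-terms; on the left, [d <= D] suffices. *)
Lemma hardy_rogers_perturbed (R : realType) (X : perturbedMetricType R)
    (T : X -> X) (a b c h e a0 b0 c0 h0 e0 : R) :
  (forall x y : X,
     odist (T x) (T y) <=
       a * odist x y + b * odist x (T x) + c * odist y (T y)
       + h * odist x (T y) + e * odist y (T x)) ->
  (forall x y : X,
     a * pert x y + b * pert x (T x) + c * pert y (T y)
       + h * pert x (T y) + e * pert y (T x) <=
     a0 * mdist x y + b0 * mdist x (T x) + c0 * mdist y (T y)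
       + h0 * mdist x (T y) + e0 * mdist y (T x)) ->
  hardy_rogers T (a + a0) (b + b0) (c + c0) (h + h0) (e + e0).
Proof.
move=> obsT pertT x y.
have odistE u v : odist u v = mdist u v + pert u v :> R.
  by rewrite mdist_pert subrK.
have := mdist_le_odist (T x) (T y).
have := obsT x y; have := pertT x y; rewrite !odistE.
lra.
Qed.

Section HardyRogers.
Context {R : realType} {X : metricType R} (T : X -> X) (A B C H E : R).
Context (A_ge0 : 0 <= A) (B_ge0 : 0 <= B) (C_ge0 : 0 <= C)
  (H_ge0 : 0 <= H) (E_ge0 : 0 <= E) (sum_lt1 : A + B + C + H + E < 1).
Context (hrT : hardy_rogers T A B C H E).

Let AHE_gt0 : 0 < 1 - (A + H + E).
Proof. by move: sum_lt1 B_ge0 C_ge0; lra. Qed.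

Lemma hardy_rogers_mdist_le (x y : X) :
  (1 - (A + H + E)) * mdist x y <=
    (1 + B + E) * mdist x (T x) + (1 + C + H) * mdist y (T y).
Proof.
(* Go from [x] to [y] through [T x] and [T y]; the cross terms with weights [H] and [E] are routed
   through [y] and [x] respectively. *)
have hr := hrT x y.
have xy := metric_triangle x (T x) y.
have Txy := metric_triangle (T x) (T y) y.
have xTy := ler_wpM2l H_ge0 (metric_triangle x y (T y)).
have yTx := ler_wpM2l E_ge0 (metric_triangle y x (T x)).
rewrite (metric_sym (T y) y) in Txy; rewrite (metric_sym y x) in yTx.
lra.
Qed.

Lemma hardy_rogers_fixed_unique (x y : X) : x = T x -> y = T y -> x = y.
Proof.
move=> xT yT; apply: mdist_positivity; apply/eqP.
rewrite eq_le mdist_ge0 andbT.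
have := hardy_rogers_mdist_le x y; rewrite -xT -yT !mdistxx !mulr0 addr0.
by rewrite pmulr_rle0// AHE_gt0.
Qed.

(** This ratio comes from adding the inequality at [(x, T x)] and at [(T x, x)]; it is below 1
    exactly when the five coefficients sum to less than 1. The pair [(x, T x)] alone gives
    [(A + B + H) / (1 - (C + H))], which can exceed 1. *)
Let k := (2 * A + B + C + H + E) / (2 - (B + C + H + E)).

Let k_ge0 : 0 <= k.
Proof.
by move: sum_lt1 A_ge0 B_ge0 C_ge0 H_ge0 E_ge0 => *; apply: divr_ge0; lra.
Qed.

Let k_lt1 : k < 1.
Proof.
by move: sum_lt1 A_ge0 B_ge0 C_ge0 H_ge0 E_ge0 => *; rewrite ltr_pdivrMr; lra.
Qed.

Lemma hardy_rogers_displacement (x : X) :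
  mdist (T x) (T (T x)) <= k * mdist x (T x).
Proof.
rewrite /k mulrAC ler_pdivlMr; last by move: sum_lt1 A_ge0; lra.
have hr := hrT x (T x); have hr' := hrT (T x) x.
have tri := ler_wpM2l (addr_ge0 H_ge0 E_ge0) (metric_triangle x (T x) (T (T x))).
rewrite !mdistxx (metric_sym (T (T x))) (metric_sym (T x) x) in hr hr'.
lra.
Qed.

Lemma hardy_rogers_displacement_iter (x : X) n :
  mdist (iter n T x) (T (iter n T x)) <= k ^+ n * mdist x (T x).
Proof.
elim: n => [|n IHn]; first by rewrite mul1r.
rewrite exprS -mulrA iterS.
by rewrite (le_trans (hardy_rogers_displacement _))// ler_wpM2l.
Qed.

Lemma hardy_rogers_asymptotically_regular (x : X) (eps : R) : 0 < eps ->
  \forall n \near \oo, mdist (iter n T x) (T (iter n T x)) < eps.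
Proof.
move=> eps_gt0.
have /cvgrPdist_lt/(_ _ eps_gt0) : k ^+ n * mdist x (T x) @[n --> \oo] --> 0.
  rewrite -[X in _ --> X](mul0r (mdist x (T x))).
  by apply: cvgMl; apply: cvg_expr; rewrite ger0_norm.
apply: filterS => n; rewrite sub0r normrN; apply: le_lt_trans.
by rewrite (le_trans (hardy_rogers_displacement_iter _ _))// ler_norm.
Qed.

Lemma hardy_rogers_cauchy (x : X) : cauchy (iter n T x @[n --> \oo]).
Proof.
apply: cauchy_exP => eps eps_gt0.
(* The weights [1 + B + E] and [1 + C + H] add up to less than 3, so 4 is a safe divisor. *)
have dlt_gt0 : 0 < (1 - (A + H + E)) * eps / 4.
  by rewrite divr_gt0// mulr_gt0.
have [N _ small] := hardy_rogers_asymptotically_regular x dlt_gt0.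
exists (iter N T x), N => // n Nn; rewrite ballEmdist /=.
rewrite -(ltr_pM2l AHE_gt0) (le_lt_trans (hardy_rogers_mdist_le _ _))//.
have sN := small N (leqnn N); have sn := small n Nn; rewrite /= in sN sn.
have := mdist_ge0 (iter N T x) (T (iter N T x)).
have := mdist_ge0 (iter n T x) (T (iter n T x)).
move: sum_lt1 A_ge0 B_ge0 C_ge0 H_ge0 E_ge0.
nra.
Qed.

(** [T] need not be continuous. Instead, for an iterate [y] near [l] with small displacement, the
    inequality at [(y, l)] gives [(1 - (C + H)) d(l, Tl) <= (1 + A + H + E) d(l, y) + (1 + B + E)
    d(y, Ty)]. Both weights on the right are below 2, hence the threshold [eps / 4]. *)
Lemma hardy_rogers_lim_fixed (x l : X) :
  iter n T x @[n --> \oo] --> l -> l = T l.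
Proof.
move=> xl; apply: mdist_positivity; apply/eqP; rewrite eq_le mdist_ge0 andbT.
have CH_gt0 : 0 < 1 - (C + H).
  by move: sum_lt1 A_ge0 B_ge0 E_ge0; lra.
rewrite -(pmulr_rle0 _ CH_gt0); apply/ler_addgt0Pl => eps eps_gt0; rewrite addr0.
have dlt_gt0 : 0 < eps / 4 by rewrite divr_gt0.
have [n [ln nTn]] : exists n, mdist l (iter n T x) < eps / 4 /\
    mdist (iter n T x) (T (iter n T x)) < eps / 4.
  have near_l : \forall n \near \oo, mdist l (iter n T x) < eps / 4.
    have := xl _ (nbhsx_ballx l _ dlt_gt0).
    by rewrite ballEmdist.
  by have [n] := filter_ex (filterI near_l
    (hardy_rogers_asymptotically_regular x dlt_gt0)); exists n.
set y := iter n T x in ln nTn.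
have hr := hrT y l.
have lTy := metric_triangle l y (T y).
have lTl := metric_triangle l (T y) (T l).
have yTl := ler_wpM2l H_ge0 (metric_triangle y l (T l)).
rewrite (metric_sym y l) in hr yTl.
have := mdist_ge0 l y; have := mdist_ge0 y (T y); have := mdist_ge0 l (T y).
move: sum_lt1 A_ge0 B_ge0 C_ge0 H_ge0 E_ge0.
nra.
Qed.

End HardyRogers.

Theorem theorem3p17 (R : realType) (X : completePerturbedMetricType R)
    (T : X -> X) (a b c h e a0 b0 c0 h0 e0 : R) :
  0 <= a -> 0 <= b -> 0 <= c -> 0 <= h -> 0 <= e ->
  0 <= a0 -> 0 <= b0 -> 0 <= c0 -> 0 <= h0 -> 0 <= e0 ->
  (forall x y : X,
     odist (T x) (T y) <=
       a * odist x y + b * odist x (T x) + c * odist y (T y)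
       + h * odist x (T y) + e * odist y (T x)) ->
  (forall x y : X,
     a * pert x y + b * pert x (T x) + c * pert y (T y)
       + h * pert x (T y) + e * pert y (T x) <=
     a0 * mdist x y + b0 * mdist x (T x) + c0 * mdist y (T y)
       + h0 * mdist x (T y) + e0 * mdist y (T x)) ->
  (a + a0) + (b + b0) + (c + c0) + (h + h0) + (e + e0) < 1 ->
  let A := a + a0 in let B := b + b0 in
  let H := h + h0 in let E := e + e0 in
  (exists! xs : X, xs = T xs) /\
  (forall xs : X, xs = T xs ->
     [/\ forall (eps : R) (u : X), 0 < eps -> odist u (T u) <= eps ->
           mdist u xs <= (1 + B + E) / (1 - (A + H + E)) * eps,
         ulam_hyers_constant T xs ((1 + B + E) / (1 - (A + H + E)))
       & ulam_hyers_stable T xs]).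
Proof.
move=> a_ge0 b_ge0 c_ge0 h_ge0 e_ge0 a0_ge0 b0_ge0 c0_ge0 h0_ge0 e0_ge0.
move=> obsT pertT sum_lt1 A B H E.
have hrT := hardy_rogers_perturbed obsT pertT.
rewrite -/A -/B -/H -/E in hrT sum_lt1; set C := c + c0 in hrT sum_lt1.
have A_ge0 : 0 <= A by exact: addr_ge0.
have B_ge0 : 0 <= B by exact: addr_ge0.
have C_ge0 : 0 <= C by exact: addr_ge0.
have H_ge0 : 0 <= H by exact: addr_ge0.
have E_ge0 : 0 <= E by exact: addr_ge0.
have AHE_gt0 : 0 < 1 - (A + H + E) by lra.
split.
  (* Any starting point would do; [point] is the one provided by nonemptiness. *)
  have /cvg_ex[xs xsP] : cvg (iter n T point @[n --> \oo]).
    apply: cauchy_cvg.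
    exact: (hardy_rogers_cauchy A_ge0 B_ge0 C_ge0 H_ge0 E_ge0 sum_lt1 hrT).
  have xs_fixed : xs = T xs.
    exact: (hardy_rogers_lim_fixed A_ge0 B_ge0 C_ge0 H_ge0 E_ge0 sum_lt1 hrT xsP).
  exists xs; split => // y.
  exact: (hardy_rogers_fixed_unique B_ge0 C_ge0 H_ge0 E_ge0 sum_lt1 hrT).
move=> xs xs_fixed.
have stable (eps : R) (u : X) : 0 < eps -> odist u (T u) <= eps ->
    mdist u xs <= (1 + B + E) / (1 - (A + H + E)) * eps.
  move=> _ u_sol; rewrite mulrAC ler_pdivlMr// mulrC.
  (* The displacement of [xs] vanishes, and that of [u] is at most its observed value since
     [d <= D]. *)
  rewrite (le_trans (hardy_rogers_mdist_le H_ge0 E_ge0 hrT _ _))//.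
  rewrite -xs_fixed mdistxx mulr0 addr0 ler_wpM2l ?addr_ge0//.
  exact: le_trans (mdist_le_odist _ _) u_sol.
have cst : ulam_hyers_constant T xs ((1 + B + E) / (1 - (A + H + E))).
  split; last exact: stable.
  by apply: divr_ge0; [rewrite !addr_ge0 | exact: ltW].
by split => //; eexists; exact: cst.
Qed.
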